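(* Let $k\ge 3$ be an integer. Let $\hat K=(-1,1)^2$, $P_{\hat K}=Q_{k-1,k}(\hat K)\times Q_{k,k-1}(\hat K)$, and let $\Sigma_{\hat K}=M_{\hat p}(\hat{\boldsymbol u})\cup M_{\hat e}(\hat{\boldsymbol u})\cup M_{\hat K}(\hat{\boldsymbol u})$ be the set of degrees of freedom described in the context. Then the finite element $(\hat K,P_{\hat K},\Sigma_{\hat K})$ is unisolvent and conforming in $H^2(\mathrm{curl})$.
   Context: Two-dimensional curls: for a vector field $\boldsymbol v=(v_1,v_2)^T$, $\nabla\times\boldsymbol v=\partial_{1}v_2-\partial_{2}v_1$ (a scalar); for a scalar $\varphi$, $\nabla\times\varphi=(\partial_{2}\varphi,-\partial_{1}\varphi)^T$; $(\nabla\times)^2\boldsymbol v=\nabla\times(\nabla\times\boldsymbol v)$. For vectors $\boldsymbol a,\boldsymbol b\in\mathbb R^2$, $\boldsymbol a\times\boldsymbol b=a_1b_2-a_2b_1$. $\hat\nabla$ denotes differentiation in the variables $\hat{\boldsymbol x}=(\hat x_1,\hat x_2)^T$ of $\hat K$. $H^2(\mathrm{curl};D)=\{\boldsymbol u\in L^2(D)^2:\ \nabla\times\boldsymbol u\in L^2(D),\ (\nabla\times)^2\boldsymbol u\in L^2(D)^2\}$. $Q_{i,j}(D)$ is the space of polynomials on $D$ of degree at most $i$ in the first variable and at most $j$ in the second; $Q_i=Q_{i,i}$. $\tilde Q_{k-3}(\hat K)$ is the space of polynomials in $Q_{k-3}(\hat K)$ with no constant term. $P_i(D)$ is the space of polynomials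 on $D$ of total degree at most $i$. $Q_{k-2}(\hat K)\cdot\hat{\boldsymbol x}=\{q\,\hat{\boldsymbol x}: q\in Q_{k-2}(\hat K)\}$. Degrees of freedom. Choose $4(k-1)$ points $\hat p_i$ on $\partial\hat K$: the 4 vertices, and $k-2$ distinct points in the interior of each of the four edges. Let $\hat e_1,\dots,\hat e_4$ be the edges of $\hat K$, with unit tangential vectors $\hat{\boldsymbol\tau}_i$. Then $$M_{\hat p}(\hat{\boldsymbol u})=\{(\hat\nabla\times\hat{\boldsymbol u})(\hat p_i): i=1,\dots,4(k-1)\},$$ $$M_{\hat e}(\hat{\boldsymbol u})=\Big\{\int_{\hat e_i}\hat{\boldsymbol u}\cdot\hat{\boldsymbol\tau}_i\,\hat q\,d\hat s:\ \hat q\in P_{k-1}(\hat e_i),\ i=1,2,3,4\Big\},$$ $$M_{\hat K}(\hat{\boldsymbol u})=\Big\{\int_{\hat K}\hat{\boldsymbol u}\cdot\hat{\boldsymbol q}\,d\hat V:\ \hat{\boldsymbol q}\in Q_{k-2}(\hat K)\cdot\hat{\boldsymbol x},\ \text{and}\ \hat{\boldsymbol q}=\hat\nabla\times\hat\varphi\ \text{with}\ \hat\varphi\in\tilde Q_{k-3}(\hat K)\Big\}.$$ (The moments are taken against bases of the indicated test spaces.) Unisolvent means: the number of degrees of freedom equals $\dim P_{\hat K}$, and if $\hat{\boldsymbol u}\in P_{\hat K}$ has all degrees of freedom equal to zero then $\hat{\boldsymbol u}=0$. Conforming in $H^2(\mathrm{curl})$ means that the tangential component and the scalar curl on each edge are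 determined by the degrees of freedom associated with that edge (so that they are continuous across edges when these degrees of freedom are shared): for every edge $\hat e_i$ with unit normal $\hat{\boldsymbol n}_i$ and every $\hat{\boldsymbol u}\in P_{\hat K}$, if $(\hat\nabla\times\hat{\boldsymbol u})(\hat p_j)=0$ at all the nodes $\hat p_j$ lying on $\hat e_i$ (including its two end points) and $\int_{\hat e_i}\hat{\boldsymbol u}\cdot\hat{\boldsymbol\tau}_i\,\hat q\,d\hat s=0$ for all $\hat q\in P_{k-1}(\hat e_i)$, then $\hat{\boldsymbol u}\times\hat{\boldsymbol n}_i=0$ and $\hat\nabla\times\hat{\boldsymbol u}=0$ on $\hat e_i$. *)

(* Defs.v *)
From HB Require Import structures.
From mathcomp Require Import all_boot all_order all_algebra.
From mathcomp Require Import all_classical all_reals all_analysis.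

Set Implicit Arguments.
Unset Strict Implicit.
Unset Printing Implicit Defensive.

Import Order.TTheory GRing.Theory Num.Theory numFieldNormedType.Exports.

Local Open Scope classical_set_scope.
Local Open Scope ring_scope.

Section LinearAlgebra.
Context {R : realType} {V : lmodType R}.

Definition is_basis (S : set V) (n : nat) (b : 'I_n -> V) : Prop :=
  [/\ forall i, S (b i),
      forall c : 'I_n -> R, \sum_i c i *: b i = 0 -> forall i, c i = 0
    & forall v, S v -> exists c : 'I_n -> R, v = \sum_i c i *: b i].

Definition has_dim (S : set V) (n : nat) : Prop :=
  exists b : 'I_n -> V, is_basis S b.

(* A finite family of degrees of freedom [Sigma] on the space [P]. *)
Definition unisolvent (P : set V) (I : finType) (Sigma : I -> V -> R) : Prop :=
  has_dim P #|I| /\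
  forall u, P u -> (forall i, Sigma i u = 0) -> u = 0.

End LinearAlgebra.

Section Fields.
Context {R : realType}.

(* The codomain is [R^o] so that scalar fields form an [lmodType R]; a vector
   field is the pair of its components. *)
Definition sfield : lmodType R := (R * R -> R^o)%type.
Definition vfield : lmodType R := (sfield * sfield)%type.

Definition partial1 (f : R * R -> R) (z : R * R) : R :=
  derive1 (fun t : R => f (t, z.2) : R^o) z.1.
Definition partial2 (f : R * R -> R) (z : R * R) : R :=
  derive1 (fun t : R => f (z.1, t) : R^o) z.2.

Definition curl (v : vfield) (z : R * R) : R :=
  partial1 v.2 z - partial2 v.1 z.
Definition vcurl (phi : sfield) : vfield :=
  (fun z => partial2 phi z, fun z => - partial1 phi z).

Definition dot (a b : R * R) : R := a.1 * b.1 + a.2 * b.2.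
Definition cross (a b : R * R) : R := a.1 * b.2 - a.2 * b.1.
Definition at_pt (v : vfield) (z : R * R) : R * R := (v.1 z, v.2 z).

(* [p`_b`_a] is the coefficient of x1^a x2^b, i.e. the outer variable of
   [p] is x2. *)
Definition eval2 (p : {poly {poly R}}) (z : R * R) : R := p.[z.2%:P].[z.1].

(* The polynomial functions all of whose monomials x1^a x2^b satisfy [E a b]. *)
Definition poly_fun (E : nat -> nat -> bool) : set sfield :=
  [set f | exists2 p : {poly {poly R}},
     forall a b, p`_b`_a != 0 -> E a b & f = eval2 p].

Definition polyQ (i j : nat) : set sfield :=
  poly_fun (fun a b => (a <= i)%N && (b <= j)%N).
Definition polyQ0 (i : nat) : set sfield :=
  poly_fun (fun a b => [&& (a <= i)%N, (b <= i)%N & (0 < a + b)%N]).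
Definition polyP (n : nat) : set sfield :=
  poly_fun (fun a b => (a + b <= n)%N).

(* The polynomials of total degree at most [n] as functions on [D]: these are
   extended by 0 outside of [D], so that two of them are equal if and only if
   they coincide on [D]. *)
Definition polyP_on (n : nat) (D : set (R * R)) : set sfield :=
  [set (q \_ D : sfield) | q in polyP n].

Definition radial (q : sfield) : vfield :=
  (fun z => q z * z.1, fun z => q z * z.2).

End Fields.

Arguments sfield R : clear implicits.
Arguments vfield R : clear implicits.

Section Square.
Context {R : realType}.

Definition Khat : set (R * R) := `]-1, 1[ `*` `]-1, 1[.

Definition vertex (i : 'I_4) : R * R :=
  nth (0, 0) [:: (-1, -1); (1, -1); (1, 1); (-1, 1)] i.

(* The [i]th edge joins [vertex i] to [vertex (ordS i)], where [ordS] is the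
   successor modulo 4. *)
Definition edge_vec (i : 'I_4) : R * R :=
  ((vertex (ordS i)).1 - (vertex i).1, (vertex (ordS i)).2 - (vertex i).2).
Definition edge_pt (i : 'I_4) (s : R) : R * R :=
  ((vertex i).1 + s * (edge_vec i).1, (vertex i).2 + s * (edge_vec i).2).
Definition edge (i : 'I_4) : set (R * R) := edge_pt i @` `[0, 1].
Definition edge_interior (i : 'I_4) : set (R * R) := edge_pt i @` `]0, 1[.

Definition unit_tangent (i : 'I_4) (t : R * R) : Prop :=
  dot t t = 1 /\ cross (edge_vec i) t = 0.
Definition unit_normal (i : 'I_4) (n : R * R) : Prop :=
  dot n n = 1 /\ dot (edge_vec i) n = 0.

Definition edge_integral (i : 'I_4) (f : R * R -> R) : R :=
  Num.sqrt (dot (edge_vec i) (edge_vec i)) *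
  Rintegral (@lebesgue_measure R) `[0, 1] (fun s : R => f (edge_pt i s)).

Definition square_integral (f : R * R -> R) : R :=
  Rintegral (@lebesgue_measure R \x @lebesgue_measure R)%E Khat f.

Definition edge_moment (t : R * R) (i : 'I_4) (q : sfield R) (u : vfield R) : R :=
  edge_integral i (fun z => dot (at_pt u z) t * q z).
Definition square_moment (q : vfield R) (u : vfield R) : R :=
  square_integral (fun z => dot (at_pt u z) (at_pt q z)).

Section Element.
Variable k : nat.

Definition PK : set (vfield R) := polyQ k.-1 k `*` polyQ k k.-1.

Definition nodes_index : finType := ('I_4 + 'I_4 * 'I_(k - 2))%type.
Definition node (pint : 'I_4 -> 'I_(k - 2) -> R * R) (j : nodes_index) : R * R :=
  match j with inl i => vertex i | inr ij => pint ij.1 ij.2 end.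

(* The summands index the degrees of freedom of M_p, of M_e, and of the two
   parts of M_K; the q's are the chosen bases of the test spaces. *)
Definition dof_index (ne : 'I_4 -> nat) (m1 m2 : nat) : finType :=
  (nodes_index + {i : 'I_4 & 'I_(ne i)} + 'I_m1 + 'I_m2)%type.
Definition dof (pint : 'I_4 -> 'I_(k - 2) -> R * R) (tau : 'I_4 -> R * R)
    (ne : 'I_4 -> nat) (qe : forall i, 'I_(ne i) -> sfield R)
    (m1 : nat) (q1 : 'I_m1 -> vfield R) (m2 : nat) (q2 : 'I_m2 -> vfield R)
    (l : dof_index ne m1 m2) (u : vfield R) : R :=
  match l with
  | inl (inl (inl j)) => curl u (node pint j)
  | inl (inl (inr ij)) =>
      edge_moment (tau (tag ij)) (tag ij) (qe (tag ij) (tagged ij)) u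
  | inl (inr j) => square_moment (q1 j) u
  | inr j => square_moment (q2 j) u
  end.

Definition conforming (pint : 'I_4 -> 'I_(k - 2) -> R * R)
    (tau : 'I_4 -> R * R) : Prop :=
  forall (i : 'I_4) (n : R * R) (u : vfield R), unit_normal i n -> PK u ->
    (forall j : nodes_index, edge i (node pint j) -> curl u (node pint j) = 0) ->
    (forall q, polyP_on k.-1 (edge i) q -> edge_moment (tau i) i q u = 0) ->
    forall z, edge i z -> cross (at_pt u z) n = 0 /\ curl u z = 0.

End Element.

End Square.

(* Main.v *)
From HB Require Import structures.
Require Import Defs.
From mathcomp Require Import all_boot all_order all_algebra.
From mathcomp Require Import all_classical all_reals all_analysis.
From mathcomp Require Import measurable_realfun polyXY zify ring lra.
Import Order.TTheory GRing.Theory Num.Theory numFieldNormedType.Exports.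
Local Open Scope classical_set_scope.
Local Open Scope ring_scope.

Set Implicit Arguments.
Unset Strict Implicit.
Unset Printing Implicit Defensive.

(** The count of degrees of freedom agrees with [dim P_K = 2 k (k + 1)], so the
    point is that a field [u = (u1, u2)] of [P_K] with vanishing degrees of
    freedom is zero.

    On an edge the tangential component of [u] is a polynomial of degree at
    most [k - 1] orthogonal to all such polynomials, in particular to itself,
    and the curl is a polynomial of degree at most [k - 1] with [k] zeros.  Both
    vanish on the edge, which is conformity ([element_conforming]).

    Suppose now that this happens on the four edges.  The curl is then divisible
    by the bubble [b = (x^2 - 1) (y^2 - 1)]: it is [r b] with [r] in [Q_(k-3)].
    Since [u] has no tangential component on the boundary, Green's formula turns
    the integral of [r (curl u)] into that of [u . curl r], an interior moment;
    the constant term of [r], absent from the test space, disappears under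
    [curl].  Hence [b r^2] has integral zero and [curl u = 0]
    ([curl_free]).  A curl-free field is a gradient, here of
    [p(x, y) = int_(-1)^y u2(x, t) dt], and [p] vanishes on the whole boundary
    because [u] is tangentially zero ([potential]).  So [p = s b] with [s] in
    [Q_(k-2)].  With [X] the position vector, the map [q |-> div (q X)]
    multiplies the monomial [x^i y^j] by
    [i + j + 2], hence it is onto on [Q_(k-2)]; choosing [q] with
    [div (q X) = s], the moment of [u = grad p] against [q X] is minus the
    integral of [p s = b s^2].  Hence [s = 0] and [u = 0] ([field_eq0]).

    These arguments take place in [{poly {poly R}}], whose outer variable ['X]
    stands for [y] and inner variable ['X%:P] for [x]; [swapXY] exchanges the
    two, so [size p] and [size (swapXY p)] control the two partial degrees.
    Integration is the algebraic functional given by a formal primitive, and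
    Lebesgue integrals meet it in [integral_horner_cc] (fundamental theorem of
    calculus) and [square_integral_eval2] (Fubini).

    For the count, the number of elements of each given basis is found by
    comparison with an explicit monomial basis of the same space. *)

(** * Polynomials determined by their values and derivatives *)

Section Primitive.
Variable A : unitRingType.
Hypothesis natS_unit : forall n, (n.+1%:R : A) \is a GRing.unit.
Implicit Type p : {poly A}.

(** In a unit ring [0^-1 = 0], so the constant coefficient of this primitive
    is [0]. *)
Definition primitive p : {poly A} :=
  \poly_(i < (size p).+1) (i%:R^-1 * p`_i.-1).

Lemma coef_primitive p i : (primitive p)`_i = i%:R^-1 * p`_i.-1.
Proof.
rewrite coef_poly; case: ltnP => // pi.
by rewrite (@nth_default _ _ p) ?mulr0// -ltnS (leq_trans pi)//; case: i pi.
Qed.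

Lemma size_primitive p : (size (primitive p) <= (size p).+1)%N.
Proof. exact: size_poly. Qed.

Lemma deriv_primitive p : (primitive p)^`() = p.
Proof.
apply/polyP => i; rewrite coef_deriv coef_primitive/= -mulrnAl.
by rewrite -[_ *+ _]mulr_natr mulVr ?mul1r.
Qed.

End Primitive.

Lemma natS_unit_field (F : numFieldType) n : (n.+1%:R : F) \is a GRing.unit.
Proof. by rewrite unitfE pnatr_eq0. Qed.

Lemma natS_unit_poly (F : numFieldType) n :
  (n.+1%:R : {poly F}) \is a GRing.unit.
Proof.
by rewrite -polyC_natr poly_unitE coefC/= size_polyC pnatr_eq0 natS_unit_field.
Qed.

Lemma deriv_eq0 (A : unitRingType) (p : {poly A}) :
  (forall n, (n.+1%:R : A) \is a GRing.unit) -> p^`() = 0 -> p = (p`_0)%:P.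
Proof.
move=> uA dp; apply/polyP => -[|i]; rewrite coefC//=.
have /eqP := congr1 (fun r : {poly A} => r`_i) dp.
rewrite coef_deriv coef0 -mulr_natr => /eqP e.
by rewrite -[LHS]mulr1 -(mulrV (uA i)) mulrA e mul0r.
Qed.

(** The uniqueness tool for the potential: two polynomials over [{poly R}]
    agree when their derivatives and one value do. *)
Lemma deriv_eq0_horner (A : unitRingType) (p : {poly A}) (a : A) :
  (forall n, (n.+1%:R : A) \is a GRing.unit) -> p^`() = 0 -> p.[a] = 0 -> p = 0.
Proof. by move=> uA /(deriv_eq0 uA) ->; rewrite hornerC => ->. Qed.

Lemma poly_eq0_seq (A : idomainType) (p : {poly A}) (x : nat -> A) :
  injective x -> (forall n, p.[x n] = 0) -> p = 0.
Proof.
move=> xinj xp; apply: (@roots_geq_poly_eq0 _ p (map x (iota 0 (size p)))).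
- by apply/allP => _ /mapP[n _ ->]; rewrite rootE xp.
- by rewrite map_inj_uniq ?iota_uniq.
- by rewrite size_map size_iota.
Qed.

Section Itv.
Variables (R : realType) (a b : R).
Hypothesis ab : a < b.

(** An explicit infinite family of points of the interval, at which to
    test polynomials. *)
Definition itv_pts n : R := a + (b - a) / n.+2%:R.

Lemma itv_pts_inj : injective itv_pts.
Proof.
move=> m n /addrI/mulfI; rewrite subr_eq0 gt_eqF// => /(_ isT)/invr_inj/eqP.
by rewrite eqr_nat => /eqP[].
Qed.

Lemma itv_pts_itv n : a < itv_pts n < b.
Proof.
have ba : 0 < b - a by rewrite subr_gt0.
rewrite ltrDl divr_gt0//= -ltrBrDl ltr_pdivrMr// ltr_pMr//.
by rewrite ltr1n.
Qed.

Lemma poly_eq0_itv (p : {poly R}) :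
  (forall x : R, a < x < b -> p.[x] = 0) -> p = 0.
Proof.
move=> h; apply: (poly_eq0_seq itv_pts_inj) => n; exact/h/itv_pts_itv.
Qed.

End Itv.

(** * Definite integrals of polynomials as algebraic functionals *)

Section DefiniteIntegral.
Variable R : realType.

Definition defint (a b : R) (p : {poly R}) : R :=
  (primitive p).[b] - (primitive p).[a].

Lemma defint_deriv a b (p : {poly R}) : defint a b p^`() = p.[b] - p.[a].
Proof.
have : (primitive p^`() - p)^`() = 0.
  by rewrite derivB deriv_primitive ?subrr//; exact: natS_unit_field.
set q := _ - _ => dq.
have qE := deriv_eq0 (@natS_unit_field R) dq.
have e : primitive p^`() = p + (q`_0)%:P by rewrite -qE /q addrC subrK.
by rewrite /defint e !hornerD !hornerC; ring.
Qed.

Lemma defintE a b (p P : {poly R}) : P^`() = p -> defint a b p = P.[b] - P.[a].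
Proof. by move=> <-; rewrite defint_deriv. Qed.

Lemma defint_zmod_morphism a b : zmod_morphism (defint a b).
Proof.
move=> p q; rewrite (@defintE _ _ _ (primitive p - primitive q)).
  by rewrite /defint !hornerD !hornerN; ring.
by rewrite derivB !deriv_primitive//; exact: natS_unit_field.
Qed.
HB.instance Definition _ a b := GRing.isZmodMorphism.Build _ _ (defint a b)
  (@defint_zmod_morphism a b).

Lemma defintZ a b c (p : {poly R}) : defint a b (c *: p) = c * defint a b p.
Proof.
rewrite (@defintE _ _ _ (c *: primitive p)).
  by rewrite /defint !hornerZ mulrBr.
by rewrite derivZ deriv_primitive//; exact: natS_unit_field.
Qed.

Lemma primitive_ndecr a b (p : {poly R}) :
  (forall x : R, a < x < b -> 0 <= p.[x]) ->
  forall x y : R, a <= x -> x <= y -> y <= b ->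
  (primitive p).[x] <= (primitive p).[y].
Proof.
move=> p0; apply: ger0_derive1_ndecr.
- by move=> x _; exact: derivable_horner.
- move=> x; rewrite in_itv/= => /p0.
  by rewrite -derivE deriv_primitive//; exact: natS_unit_field.
- exact/continuous_subspaceT/continuous_horner.
Qed.

Lemma defint_ge0 a b (p : {poly R}) : a < b ->
  (forall x : R, a < x < b -> 0 <= p.[x]) -> 0 <= defint a b p.
Proof. by move=> ab /primitive_ndecr h; rewrite subr_ge0 h// ltW. Qed.

(** A nonnegative integrand has a nondecreasing primitive; equal values at the
    end points force it to be constant, and its derivative is the integrand. *)
Lemma defint_eq0 a b (p : {poly R}) : a < b ->
  (forall x : R, a < x < b -> 0 <= p.[x]) -> defint a b p = 0 -> p = 0.
Proof.
move=> ab /primitive_ndecr h /eqP; rewrite subr_eq0 => /eqP Pab.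
have : primitive p - (primitive p).[a]%:P = 0.
  apply: (poly_eq0_itv ab) => x /andP[/ltW ax /ltW xb].
  rewrite hornerD hornerN hornerC; apply/eqP; rewrite subr_eq0 eq_le.
  by rewrite -{1}Pab !h.
move=> /(congr1 (@deriv R)); rewrite derivB derivC subr0 deriv0.
by rewrite deriv_primitive//; exact: natS_unit_field.
Qed.

Lemma defint_sqr_eq0 a b (p : {poly R}) : a < b -> defint a b (p * p) = 0 -> p = 0.
Proof.
move=> ab /(defint_eq0 ab) => /(_ _)/eqP; rewrite mulf_eq0 orbb => h.
by apply/eqP/h => x _; rewrite hornerM -expr2 sqr_ge0.
Qed.

End DefiniteIntegral.

Section Bivariate.
Variable R : realType.
Local Notation poly2 := {poly {poly R}}.
Implicit Types (p q : poly2).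

(** The derivative in the inner variable; the derivative in the outer
    variable is the usual [p^`()]. *)
Definition pderivX p : poly2 := map_poly (@deriv R) p.

Lemma coef_pderivX p i : (pderivX p)`_i = (p`_i)^`().
Proof. exact: coef_map. Qed.

Lemma swapXY_pderivX p : swapXY (pderivX p) = (swapXY p)^`().
Proof.
apply/polyP => i; apply/polyP => j.
by rewrite coef_swapXY coef_pderivX coef_deriv coefMn !coef_deriv coef_swapXY.
Qed.

Lemma pderivXE p : pderivX p = swapXY (swapXY p)^`().
Proof. by rewrite -swapXY_pderivX swapXYK. Qed.

Lemma pderivXD p q : pderivX (p + q) = pderivX p + pderivX q.
Proof. exact: raddfD. Qed.

Lemma pderivXB p q : pderivX (p - q) = pderivX p - pderivX q.
Proof. exact: raddfB. Qed.

Lemma pderivXM p q : pderivX (p * q) = pderivX p * q + p * pderivX q.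
Proof.
rewrite !pderivXE rmorphM derivM [swapXY (_ + _)]rmorphD/=.
by rewrite ![swapXY (_ * _)]rmorphM/= !swapXYK.
Qed.

Lemma deriv_pderivX p : (pderivX p)^`() = pderivX p^`().
Proof.
apply/polyP => i.
by rewrite coef_deriv !coef_pderivX coef_deriv raddfMn.
Qed.

Lemma horner_pderivX p (c : R) : (pderivX p).[c%:P] = (p.[c%:P])^`().
Proof. by rewrite !horner_polyC swapXY_pderivX deriv_map. Qed.

Lemma size_pderivX p : (size (pderivX p) <= size p)%N.
Proof. exact: size_poly. Qed.

Lemma size_swap_deriv p : (size (swapXY p^`()) <= size (swapXY p))%N.
Proof. by rewrite -[p in p^`()]swapXYK -swapXY_pderivX swapXYK size_pderivX. Qed.

Lemma size_swapP p n :
  (forall j, (size (p`_j)%R <= n)%N) <-> (size (swapXY p) <= n)%N.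
Proof.
rewrite -sizeYE; split=> [h|h j]; first by apply/bigmax_leqP.
by rewrite (leq_trans (max_size_coefXY _ _)).
Qed.

Lemma size_coef_swap p j : (size (p`_j)%R <= size (swapXY p))%N.
Proof. by rewrite -sizeYE max_size_coefXY. Qed.

(** The integral over the square: first in the inner variable, coefficient by
    coefficient, then in the outer one. *)
Definition defint2 p : R := defint (-1) 1 (map_poly (defint (-1) 1) p).

HB.instance Definition _ := GRing.Additive.copy defint2
  (defint (-1) 1 \o map_poly (defint (-1) 1)).

Lemma horner_defint p (y a b : R) :
  (map_poly (defint a b) p).[y] = defint a b p.[y%:P].
Proof.
rewrite (@horner_coef_wide _ (size p)) ?size_poly// horner_coef raddf_sum.
apply: eq_bigr => i _.
by rewrite coef_map/= -rmorphXn/= [p`_i * _]mulrC mul_polyC defintZ mulrC.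
Qed.

Lemma defint2Z c p : defint2 (c%:P *: p) = c * defint2 p.
Proof.
rewrite /defint2 -defintZ; congr defint; apply/polyP => i.
by rewrite coefZ !coef_map/= coefZ mul_polyC defintZ.
Qed.

(** This lemma and the next are the divergence theorem for fields that vanish
    on the sides they flow through. *)
Lemma defint2_derivY p : p.[1%:P] = 0 -> p.[(-1)%:P] = 0 -> defint2 p^`() = 0.
Proof.
move=> p1 pN1; rewrite /defint2.
have -> : map_poly (defint (-1) 1) p^`() = (map_poly (defint (-1) 1) p)^`() :> {poly R}.
  by apply/polyP => i; rewrite coef_deriv !coef_map/= coef_deriv raddfMn.
by rewrite defint_deriv !horner_defint p1 pN1 subrr.
Qed.

Lemma defint2_pderivX p :
  (swapXY p).[1%:P] = 0 -> (swapXY p).[(-1)%:P] = 0 -> defint2 (pderivX p) = 0.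
Proof.
rewrite !horner_swapXY => p1 pN1; rewrite /defint2.
suff -> : map_poly (defint (-1) 1) (pderivX p) = 0 by rewrite raddf0.
apply/polyP => i; rewrite coef_map/= coef_pderivX defint_deriv coef0.
have c1 (c : R) : (map_poly (horner_eval c) p)`_i = (p`_i).[c].
  exact: coef_map.
by rewrite -!c1 p1 pN1 !coef0 subrr.
Qed.

(** The inner integral is a nonnegative polynomial in [y] of integral zero, so
    it vanishes identically; then so does each slice of [p], first for [y] in
    the interval, which is enough. *)
Lemma defint2_eq0 p :
  (forall x y : R, -1 < x < 1 -> -1 < y < 1 -> 0 <= p.[y%:P].[x]) ->
  defint2 p = 0 -> p = 0.
Proof.
have N11 : (-1 : R) < 1 by lra.
move=> p0 /(defint_eq0 N11) h.
have {}h : map_poly (defint (-1) 1) p = 0 :> {poly R}.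
  apply: h => y hy; rewrite horner_defint defint_ge0// => x hx; exact: p0.
apply: (@poly_eq0_seq _ _ (fun n => (itv_pts (-1) 1 n)%:P)).
  by move=> m n /polyC_inj/itv_pts_inj; exact.
move=> n; set y := itv_pts _ _ n; apply: (defint_eq0 N11) => [x hx|].
  by apply: p0; rewrite // itv_pts_itv.
by rewrite -horner_defint h horner0.
Qed.

End Bivariate.

(** * The boundary bubble and the two exactness arguments *)

Lemma factor_pm1 (A : idomainType) (p : {poly A}) : (1 : A) != -1 ->
  p.[1] = 0 -> p.[-1] = 0 -> exists r, p = r * ('X^2 - 1).
Proof.
move=> n11 /rootP/factor_theorem[q ->].
rewrite hornerM hornerXsubC => /eqP; rewrite mulf_eq0 orbC -opprD oppr_eq0.
rewrite addr_eq0 (negPf n11)/= => /factor_theorem[r ->]; exists r.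
by rewrite -mulrA; congr (_ * _); rewrite polyCN polyC1; ring.
Qed.

Section Bubble.
Variable R : realType.
Local Notation poly2 := {poly {poly R}}.
Implicit Types (p q r : poly2).

Definition vanish_bdry p : Prop :=
  [/\ p.[1%:P] = 0, p.[(-1)%:P] = 0,
      (swapXY p).[1%:P] = 0 & (swapXY p).[(-1)%:P] = 0].

Definition bubble : poly2 := ('X^2 - 1) * ('X^2 - 1)%:P.

Lemma poly1_neqN1 : (1 : {poly R}) != -1.
Proof. by rewrite -polyC1 -polyCN (inj_eq polyC_inj); apply/eqP; lra. Qed.

Lemma swapXY_Xsqr : swapXY ('X^2 - 1) = ('X^2 - 1)%:P :> poly2.
Proof. by rewrite rmorphB rmorphXn/= swapXY_X rmorph1 polyCB polyC_exp. Qed.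

Lemma swapXY_bubble : swapXY bubble = bubble.
Proof. by rewrite /bubble rmorphM/= -swapXY_Xsqr swapXYK mulrC. Qed.

Lemma Xsqr_neq0 (A : nzRingType) : ('X^2 - 1 : {poly A}) != 0.
Proof. by rewrite -polyC1 -size_poly_eq0 size_XnsubC. Qed.

(** Vanishing at [y = 1] and [y = -1] gives the factor [y^2 - 1] over the ring
    [{poly R}].  The quotient still vanishes at [x = 1] and [x = -1], because
    [y^2 - 1] can be cancelled there, so the argument applies once more with
    the variables exchanged. *)
Lemma bubble_factor p : vanish_bdry p -> exists r, p = r * bubble.
Proof.
case; rewrite polyCN polyC1 => p1 pN1.
have [r ->] := factor_pm1 poly1_neqN1 p1 pN1.
rewrite rmorphM/= swapXY_Xsqr !hornerM !hornerC.
move/eqP; rewrite mulf_eq0 (negPf (Xsqr_neq0 _)) orbF => /eqP r1.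
move/eqP; rewrite mulf_eq0 (negPf (Xsqr_neq0 _)) orbF => /eqP rN1.
have [s e] := factor_pm1 poly1_neqN1 r1 rN1.
exists (swapXY s).
rewrite -[r]swapXYK e rmorphM/= swapXY_Xsqr /bubble; ring.
Qed.

Lemma size_mul_bubble r : r != 0 -> size (r * bubble) = (size r).+2.
Proof.
move=> r0; rewrite /bubble mulrA mulrC mul_polyC size_scale ?Xsqr_neq0//.
by rewrite -polyC1 size_Mmonic ?monicXnsubC// size_XnsubC// addn3.
Qed.

Lemma size_swap_mul_bubble r : r != 0 ->
  size (swapXY (r * bubble)) = (size (swapXY r)).+2.
Proof.
by move=> r0; rewrite rmorphM/= swapXY_bubble size_mul_bubble// swapXY_eq0.
Qed.

(** The bubble is nonnegative on the square, so it is a weight for the inner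
    product of polynomials. *)
Lemma bubble_sqr_eq0 r : defint2 (r * bubble * r) = 0 -> r = 0.
Proof.
move=> /defint2_eq0 h; apply/eqP; have : r * bubble * r == 0.
  apply/eqP/h => x y /andP[xN1 x1] /andP[yN1 y1].
  have sqrE (A : comNzRingType) (a : A) : ('X^2 - 1).[a] = a ^+ 2 - 1.
    by rewrite hornerD hornerN hornerXn hornerC.
  rewrite /bubble !hornerM hornerC !sqrE.
  rewrite hornerD hornerN hornerC -polyC_exp hornerC.
  have e (c : R) : c * ((y ^+ 2 - 1) * (x ^+ 2 - 1)) * c =
      c ^+ 2 * ((1 - y ^+ 2) * (1 - x ^+ 2)) by ring.
  rewrite e mulr_ge0 ?sqr_ge0//; apply: mulr_ge0; nra.
by rewrite !mulf_eq0 polyC_eq0 !(negPf (Xsqr_neq0 _)) !orbF orbb.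
Qed.

Lemma size_swap_primitive p : (size (swapXY (primitive p)) <= size (swapXY p))%N.
Proof.
apply/size_swapP => j; rewrite coef_primitive.
apply: (@leq_trans (size (p`_j.-1)%R)); last exact: size_coef_swap.
by rewrite -polyC_natr polyCV mul_polyC size_scale_leq.
Qed.

(** The field [q (x, y)] has divergence [2 q + x q_x + y q_y], which acts on the
    monomial [x^i y^j] as multiplication by [i + j + 2]; this is the inverse of
    that operator. *)
Definition euler_inv p : poly2 :=
  \poly_(j < size p) \poly_(i < size p`_j) (p`_j`_i / (i + j).+2%:R).

Lemma coef_euler_inv p i j : (euler_inv p)`_j`_i = p`_j`_i / (i + j).+2%:R.
Proof.
rewrite coef_poly; case: ltnP => jp; last by rewrite (nth_default _ jp) coef0 mul0r.
by rewrite coef_poly; case: ltnP => // ip; rewrite (nth_default _ ip) mul0r.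
Qed.

Lemma size_euler_inv p : (size (euler_inv p) <= size p)%N.
Proof. exact: size_poly. Qed.

Lemma size_swap_euler_inv p : (size (swapXY (euler_inv p)) <= size (swapXY p))%N.
Proof.
apply/size_swapP => j; apply: (@leq_trans (size (p`_j)%R)); last exact: size_coef_swap.
rewrite coef_poly; case: ltnP => jp; last by rewrite size_poly0.
exact: size_poly.
Qed.

Lemma div_euler_inv p :
  pderivX (euler_inv p * 'X%:P) + (euler_inv p * 'X)^`() = p.
Proof.
apply/polyP => j; apply/polyP => i.
rewrite coefD coef_pderivX coef_deriv coefMX/= coefMC coefD coef_deriv coefMX/=.
by rewrite coefMn coef_euler_inv -mulrnDr addSn addnS -[LHS]mulr_natr mulfVK//.
Qed.

End Bubble.

Section Exactness.
Variable R : realType.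
Local Notation poly2 := {poly {poly R}}.
Variables (n : nat) (U1 U2 : poly2).
Hypothesis sU1 : (size U1 <= n.+4)%N.
Hypothesis sU1' : (size (swapXY U1) <= n.+3)%N.
Hypothesis sU2 : (size U2 <= n.+3)%N.
Hypothesis sU2' : (size (swapXY U2) <= n.+4)%N.
Hypothesis U1_1 : U1.[1%:P] = 0.
Hypothesis U1_N1 : U1.[(-1)%:P] = 0.
Hypothesis U2_1 : (swapXY U2).[1%:P] = 0.
Hypothesis U2_N1 : (swapXY U2).[(-1)%:P] = 0.

(** The curl is [r b]; integrating by parts against [r], or equivalently
    against [r] minus its constant term, leaves only the interior moment of the
    field against [curl r]. *)
Lemma curl_free :
  vanish_bdry (pderivX U2 - U1^`()) ->
  (forall phi : poly2, (size phi <= n.+1)%N -> (size (swapXY phi) <= n.+1)%N ->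
     phi`_0`_0 = 0 -> defint2 (U1 * phi^`() - U2 * pderivX phi) = 0) ->
  pderivX U2 = U1^`().
Proof.
move=> /bubble_factor[r er] h; apply/eqP; rewrite -subr_eq0 er.
have sr : r != 0 -> (size r <= n.+1)%N.
  move=> r0; rewrite -2!ltnS -size_mul_bubble// -er.
  rewrite (leq_trans (size_polyD _ _))// size_polyN geq_max.
  rewrite (leq_trans (size_pderivX _))//=.
  by rewrite (leq_trans (size_poly _ _))//; case: (size U1) sU1.
have sr' : r != 0 -> (size (swapXY r) <= n.+1)%N.
  move=> r0; rewrite -2!ltnS -size_swap_mul_bubble// -er rmorphB/= swapXY_pderivX.
  rewrite (leq_trans (size_polyD _ _))// size_polyN geq_max.
  rewrite (leq_trans (size_swap_deriv _)) ?andbT//.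
  by rewrite (leq_trans (size_poly _ _))//; case: (size (swapXY U2)) sU2'.
have [->|r0] := eqVneq r 0; first by rewrite mul0r.
(* the constant term of [r], invisible to the derivatives *)
pose c : poly2 := (r`_0`_0)%:P%:P.
have dc : c^`() = 0 by rewrite derivC.
have dcX : pderivX c = 0 by rewrite /pderivX map_polyC/= derivC.
have sc : (size c <= 1)%N by rewrite size_polyC leq_b1.
have swc : swapXY c = c by rewrite swapXY_polyC map_polyC.
have /h : (size (r - c)%R <= n.+1)%N.
  by rewrite (leq_trans (size_polyD _ _))// size_polyN geq_max sr//= (leq_trans sc).
rewrite rmorphB/= swc coefB coefC/= coefB coefC/= subrr.
rewrite (leq_trans (size_polyD _ _)) ?size_polyN ?geq_max ?sr' ?(leq_trans sc)//.
move=> /(_ isT erefl); rewrite derivB pderivXB dc dcX !subr0 => J0.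
rewrite (@bubble_sqr_eq0 _ r) ?mul0r// -er.
have -> : (pderivX U2 - U1^`()) * r = pderivX (U2 * r) - (U1 * r)^`() +
    (U1 * r^`() - U2 * pderivX r) by rewrite pderivXM derivM; ring.
rewrite raddfD raddfB/= J0 addr0 defint2_pderivX ?defint2_derivY ?subrr//.
- by rewrite hornerM U1_1 mul0r.
- by rewrite hornerM U1_N1 mul0r.
- by rewrite rmorphM hornerM U2_1 mul0r.
- by rewrite rmorphM hornerM U2_N1 mul0r.
Qed.

(** The potential is the integral of [U2] in [y] from the side [y = -1].  It
    has the right derivative in [x] because [U1] vanishes on that side, and it
    vanishes at [x = 1] and [x = -1] because [U2] does.  On [y = 1] its
    derivative in [x] is [U1], which is zero there. *)
Lemma potential : pderivX U2 = U1^`() ->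
  exists p : poly2, [/\ pderivX p = U1, p^`() = U2, vanish_bdry p,
    (size p <= n.+4)%N & (size (swapXY p) <= n.+4)%N].
Proof.
move=> cf; have uR := @natS_unit_field R; have uP := @natS_unit_poly R.
pose P := primitive U2; pose p := P - (P.[(-1)%:P])%:P.
have pN1 : p.[(-1)%:P] = 0 by rewrite hornerD hornerN hornerC subrr.
have dp : p^`() = U2 by rewrite derivB derivC subr0 deriv_primitive.
have dXp : pderivX p = U1.
  apply/eqP; rewrite -subr_eq0; apply/eqP/(@deriv_eq0_horner _ _ (-1)%:P) => //.
    by rewrite derivB deriv_pderivX dp cf subrr.
  by rewrite hornerD hornerN horner_pderivX pN1 deriv0 U1_N1 subrr.
have side c : (swapXY U2).[c%:P] = 0 -> (swapXY p).[c%:P] = 0.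
  rewrite !horner_swapXY => U2c.
  apply: (@deriv_eq0_horner _ _ (-1)) => //; first by rewrite deriv_map dp.
  by rewrite -horner_swapXY horner2_swapXY pN1 horner0.
have p1 : p.[1%:P] = 0.
  apply: (@deriv_eq0_horner _ _ (-1)) => //.
    by rewrite -horner_pderivX dXp.
  by rewrite -horner2_swapXY (side _ U2_N1) horner0.
exists p; split => //; first by split=> //; exact: side.
  rewrite (leq_trans (size_polyD _ _))// size_polyN geq_max.
  rewrite (leq_trans (size_primitive _))//=.
  by rewrite (leq_trans (size_polyC_leq1 _)).
rewrite rmorphB/= swapXY_polyC (leq_trans (size_polyD _ _))// size_polyN geq_max.
rewrite (leq_trans (size_swap_primitive _))//= size_map_polyC.
rewrite horner_polyC (leq_trans (size_poly _ _))//.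
by rewrite (leq_trans (size_swap_primitive _)).
Qed.

(** Testing the gradient of [p = s b] against the radial field [q (x, y)] of
    divergence [s] gives minus the integral of [b s^2]. *)
Lemma field_eq0 :
  pderivX U2 = U1^`() ->
  (forall q : poly2, (size q <= n.+2)%N -> (size (swapXY q) <= n.+2)%N ->
     defint2 (U1 * (q * 'X%:P) + U2 * (q * 'X)) = 0) ->
  U1 = 0 /\ U2 = 0.
Proof.
move=> /potential[p [<- <- vp sp sp']] h.
have [s es] := bubble_factor vp.
suff s0 : s = 0 by rewrite es s0 mul0r deriv0 /pderivX map_poly0.
have [->//|s0] := eqVneq s 0.
have ss : (size s <= n.+2)%N by rewrite -2!ltnS -size_mul_bubble// -es.
have ss' : (size (swapXY s) <= n.+2)%N by rewrite -2!ltnS -size_swap_mul_bubble// -es.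
have := h (euler_inv s) (leq_trans (size_euler_inv _) ss)
  (leq_trans (size_swap_euler_inv _) ss').
set q := euler_inv s => J0; apply: bubble_sqr_eq0; rewrite -es.
have -> : p * s = pderivX (p * (q * 'X%:P)) + (p * (q * 'X))^`() -
   (pderivX p * (q * 'X%:P) + p^`() * (q * 'X)).
  by rewrite -{1}(div_euler_inv s) (pderivXM p) (derivM p) -/q; ring.
case: vp => p1 pN1 p1' pN1'.
rewrite raddfB/= J0 subr0 raddfD/= defint2_pderivX ?defint2_derivY ?addr0//.
- by rewrite hornerM p1 mul0r.
- by rewrite hornerM pN1 mul0r.
- by rewrite rmorphM hornerM p1' mul0r.
- by rewrite rmorphM hornerM pN1' mul0r.
Qed.

End Exactness.

(** * Partial derivatives and Lebesgue integrals of polynomial functions *)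

Section Calculus.
Variable R : realType.
Local Notation poly2 := {poly {poly R}}.
Implicit Types (p q : poly2).

Lemma eval2_swap p (x y : R) : eval2 p (x, y) = (swapXY p).[x%:P].[y].
Proof. by rewrite horner2_swapXY. Qed.

Lemma partial1_eval2 p : partial1 (eval2 p) = eval2 (pderivX p).
Proof.
apply/funext => z; rewrite /partial1 /eval2/= horner_pderivX derivE.
by [].
Qed.

Lemma partial2_eval2 p : partial2 (eval2 p) = eval2 p^`().
Proof.
apply/funext => -[x y]; rewrite /partial2 /=.
rewrite (_ : (fun t => eval2 p (x, t)) = horner (swapXY p).[x%:P]); last first.
  by apply/funext => t; rewrite eval2_swap.
rewrite -derivE -horner_pderivX eval2_swap; congr (_.[_].[_]).
by rewrite -[p in RHS]swapXYK -swapXY_pderivX swapXYK.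
Qed.

Lemma eval2D p q : eval2 (p + q) = (fun z => eval2 p z + eval2 q z).
Proof. by apply/funext => z; rewrite /eval2 !hornerD. Qed.

Lemma eval2N p : eval2 (- p) = (fun z => - eval2 p z).
Proof. by apply/funext => z; rewrite /eval2 !hornerN. Qed.

Lemma eval2M p q z : eval2 (p * q) z = eval2 p z * eval2 q z.
Proof. by rewrite /eval2 !hornerM. Qed.

Lemma curl_eval2 p q :
  curl (eval2 p, eval2 q) = eval2 (pderivX q - p^`()).
Proof.
apply/funext => z.
by rewrite /curl/= partial1_eval2 partial2_eval2 eval2D eval2N.
Qed.

Lemma vcurl_eval2 p : vcurl (eval2 p) = (eval2 p^`(), eval2 (- pderivX p)).
Proof. by rewrite /vcurl partial1_eval2 partial2_eval2 eval2N. Qed.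

Lemma integral_horner_cc (a b : R) (p : {poly R}) : a < b ->
  (\int[@lebesgue_measure R]_(x in `[a, b]) (p.[x])%:E = (defint a b p)%:E)%E.
Proof.
move=> ab; rewrite (@continuous_FTC2 _ _ (horner (primitive p)))//=.
- exact/continuous_subspaceT/continuous_horner.
- split => [x _||]; first exact: derivable_horner.
  + exact/cvg_at_right_filter/continuous_horner.
  + exact/cvg_at_left_filter/continuous_horner.
- by move=> x _; rewrite -derivE deriv_primitive//; exact: natS_unit_field.
Qed.

Lemma measurable_horner (p : {poly R}) : measurable_fun setT (horner p : R -> R).
Proof. by apply: continuous_measurable_fun; exact: continuous_horner. Qed.

Lemma integral_horner_oo (a b : R) (p : {poly R}) : a < b ->
  (\int[@lebesgue_measure R]_(x in `]a, b[) (p.[x])%:E = (defint a b p)%:E)%E.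
Proof.
move=> ab; rewrite -(@integral_itv_bndoo _ _ _ _ true false) ?integral_horner_cc//.
by apply: measurableT_comp => //; apply: measurable_funTS; exact: measurable_horner.
Qed.

Lemma eval2E p z : eval2 p z = \sum_(i < size p) (p`_i).[z.1] * z.2 ^+ i.
Proof.
rewrite /eval2 (horner_coef p) horner_sum; apply: eq_bigr => i _.
by rewrite hornerM -polyC_exp hornerC.
Qed.

Lemma measurable_eval2 p : measurable_fun setT (eval2 p).
Proof.
rewrite (_ : eval2 p = fun z => \sum_(i < size p) (p`_i).[z.1] * z.2 ^+ i); last first.
  by apply/funext => z; rewrite eval2E.
apply: measurable_sum => i; apply: measurable_funM.
  exact: (measurableT_comp (measurable_horner _) measurable_fst).
exact: measurable_funX.
Qed.

Lemma horner_bounded (p : {poly R}) : exists M : R,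
  forall x : R, -1 < x < 1 -> `|p.[x]| <= M.
Proof.
exists (\sum_(i < size p) `|p`_i|) => x x1.
rewrite horner_coef (le_trans (ler_norm_sum _ _ _))// ler_sum// => i _.
rewrite normrM normrX ler_piMr// exprn_ile1//.
by rewrite ler_norml; lra.
Qed.

Lemma eval2_bounded p : exists M : R, forall z, Khat z -> `|eval2 p z| <= M.
Proof.
have /choice[M MP] : forall i : 'I_(size p), exists M : R,
    forall x : R, -1 < x < 1 -> `|(p`_i).[x]| <= M.
  by move=> i; exact: horner_bounded.
exists (\sum_(i < size p) M i) => -[x y] [/=]; rewrite !in_itv/= => hx hy.
rewrite eval2E (le_trans (ler_norm_sum _ _ _))// ler_sum// => i _ /=.
rewrite normrM normrX (le_trans _ (MP i _ hx))// ler_piMr// exprn_ile1//.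
by rewrite ler_norml; lra.
Qed.

Lemma measurable_Khat : measurable (@Khat R).
Proof. by apply: measurableX; exact: measurable_itv. Qed.

(** Fubini's theorem applies because a polynomial is bounded on the square,
    which has finite measure. *)
Lemma square_integral_eval2 p : square_integral (eval2 p) = defint2 p.
Proof.
have N11 : (-1 : R) < 1 by lra.
pose mu := (@lebesgue_measure R \x @lebesgue_measure R)%E.
have muK : (mu Khat < +oo)%E.
  rewrite /mu product_measure1E//; try exact: measurable_itv.
  by rewrite /= !lebesgue_measure_itv/= !lte_fin N11/= -EFinB -EFinM ltry.
have itf : mu.-integrable Khat (EFin \o eval2 p).
  apply: measurable_bounded_integrable => //; first exact: measurable_Khat.
    by apply: measurable_funTS; exact: measurable_eval2.
  have [M MP] := eval2_bounded p; exists M; split => [|N MN z /MP h].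
    exact: num_real.
  by apply: le_trans (ltW MN); exact: h.
rewrite /square_integral /Rintegral integral_mkcond -integral21_prod_meas1; last first.
  by apply/integrable_restrict; rewrite ?setTI//; exact: measurable_Khat.
pose h := map_poly (defint (-1) 1) p : {poly R}.
rewrite /defint2 -[RHS]/(fine (defint (-1) 1 h)%:E) -integral_horner_oo//.
congr fine; rewrite [RHS]integral_mkcond; apply: eq_integral.
move=> y _; rewrite /fubini_G patchE; case: ifPn => yN.
  rewrite /h horner_defint -integral_horner_oo// [RHS]integral_mkcond.
  apply: eq_integral => x _; rewrite !patchE; congr (if _ then _ else _).
  by rewrite /Khat in_setX/= yN andbT.
rewrite integral0_eq// => x _; rewrite patchE ifF//.
by rewrite /Khat in_setX/= (negPf yN) andbF.
Qed.
End Calculus.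

(** * Bases and dimensions of polynomial spaces *)

Section Bases.
Variable R : realType.

(** Bases indexed by a finite type, so that products and subtypes can index
    monomials. *)
Definition fin_basis (V : lmodType R) (T : finType) (S : set V) (b : T -> V) :=
  [/\ forall t, S (b t),
      forall c : T -> R, \sum_t c t *: b t = 0 -> forall t, c t = 0
    & forall v, S v -> exists c : T -> R, v = \sum_t c t *: b t].

Lemma fin_basis_dim (V : lmodType R) (T : finType) (S : set V) (b : T -> V) :
  fin_basis S b -> has_dim S #|T|.
Proof.
move=> [Sb freeb spanb]; exists (b \o enum_val).
have sumE c : \sum_t c t *: b t = \sum_(i < #|T|) c (enum_val i) *: b (enum_val i).
  rewrite (reindex (@enum_val T T))//.
  by exists enum_rank => x _; [exact: enum_valK|exact: enum_rankK].
split=> [i|c c0 i|v /spanb[c ->]]; first exact: Sb.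
- rewrite -(enum_valK i); apply: (freeb (c \o enum_rank)); rewrite sumE -[RHS]c0.
  by apply: eq_bigr => j _ /=; rewrite enum_valK.
- by exists (c \o enum_val); exact: sumE.
Qed.

(** Expanding two bases in each other gives matrices [A] and [B] with
    [A *m B = 1]. *)
Lemma basis_card_le (V : lmodType R) (S : set V) (m n : nat)
    (b : 'I_m -> V) (b' : 'I_n -> V) :
  is_basis S b -> is_basis S b' -> (m <= n)%N.
Proof.
move=> [Sb freeb spanb] [Sb' _ spanb'].
have /choice[A AP] := fun i => spanb' _ (Sb i).
have /choice[B BP] := fun j => spanb _ (Sb' j).
apply: (@mulmx1_min R _ _ (\matrix_(i, j) A i j) (\matrix_(j, i) B j i)).
apply/matrixP => i l; rewrite !mxE.
apply/eqP; rewrite -subr_eq0; apply/eqP; move: l; apply: freeb.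
under eq_bigr do rewrite scalerBl; rewrite sumrB; apply/eqP; rewrite subr_eq0.
have -> : \sum_l (i == l)%:R *: b l = b i.
  rewrite (bigD1 i)//= eqxx scale1r big1 ?addr0// => l li.
  by rewrite eq_sym (negPf li) scale0r.
apply/eqP; rewrite [RHS]AP; under [RHS]eq_bigr do rewrite BP scaler_sumr.
rewrite [RHS]exchange_big/=; apply: eq_bigr => l _; rewrite scaler_suml.
by apply: eq_bigr => j _; rewrite !mxE scalerA.
Qed.

Lemma dim_unique (V : lmodType R) (S : set V) (m n : nat) (b : 'I_m -> V) :
  is_basis S b -> has_dim S n -> m = n.
Proof.
move=> bb [c cb]; apply/eqP.
by rewrite eqn_leq !(basis_card_le bb cb, basis_card_le cb bb).
Qed.

Lemma fin_basis_prod (V W : lmodType R) (T U : finType) (S : set V) (S' : set W)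
    (b : T -> V) (b' : U -> W) : fin_basis S b -> fin_basis S' b' ->
  S 0 -> S' 0 ->
  fin_basis (S `*` S') (fun t : T + U =>
    match t with inl x => (b x, 0) | inr y => (0, b' y) end : V * W).
Proof.
move=> [Sb freeb spanb] [Sb' freeb' spanb'] S0 S0'.
have sumE (c : T + U -> R) : \sum_t c t *: (match t with inl x => (b x, 0)
     | inr y => (0, b' y) end : V * W) =
   (\sum_x c (inl x) *: b x, \sum_y c (inr y) *: b' y).
  rewrite big_sumType/= [RHS]surjective_pairing/=.
  have -> : \sum_x c (inl x) *: ((b x, 0) : V * W) = (\sum_x c (inl x) *: b x, 0).
    rewrite [LHS]surjective_pairing; congr pair.
      by rewrite (raddf_sum fst).
    by rewrite (raddf_sum snd) big1// => x _; rewrite /= scaler0.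
  have -> : \sum_x c (inr x) *: ((0, b' x) : V * W) = (0, \sum_x c (inr x) *: b' x).
    rewrite [LHS]surjective_pairing; congr pair.
      by rewrite (raddf_sum fst) big1// => x _; rewrite /= scaler0.
    by rewrite (raddf_sum snd).
  by rewrite [LHS]surjective_pairing/= addr0 add0r.
split=> [[x|y]|c|[v w] [/= /spanb[c ->] /spanb'[c' ->]]]; first by split => /=.
- by split => /=.
- rewrite sumE => -[cx cy] [x|y]; first exact: (freeb (c \o inl)).
  exact: (freeb' (c \o inr)).
- by exists (fun t => match t with inl x => c x | inr y => c' y end); rewrite sumE.
Qed.

Local Notation poly2 := {poly {poly R}}.
Implicit Types (p q : poly2).

Definition polys_in (E : nat -> nat -> bool) : set poly2 :=
  [set p : poly2 | forall a b, p`_b`_a != 0 -> E a b].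

(** Linearity over [R] is stated by hand, since the module structure of
    [{poly {poly R}}] has scalars [{poly R}]. *)
Definition Rlinear (V : lmodType R) (g : poly2 -> V) : Prop :=
  (forall p q, g (p + q) = g p + g q) /\
  (forall (c : R) p, g (c%:P *: p) = c *: g p).

Lemma Rlinear0 (V : lmodType R) (g : poly2 -> V) : Rlinear g -> g 0 = 0.
Proof. by move=> [_ gZ]; have := gZ 0 0; rewrite polyC0 !scale0r. Qed.

Lemma Rlinear_sum (V : lmodType R) (g : poly2 -> V) (I : finType)
    (c : I -> R) (F : I -> poly2) : Rlinear g ->
  g (\sum_i (c i)%:P *: F i) = \sum_i c i *: g (F i).
Proof.
move=> gl; have [gD gZ] := gl.
by elim/big_rec2: _ => [|i y x _ <-]; [exact: Rlinear0 | rewrite gD gZ].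
Qed.

(** A moment that vanishes on a basis of test functions vanishes on their span.
    The functional [m] need not be linear on all of [V]: integrals are additive
    only on integrable functions.  It is enough that it be linear on the
    functions represented by polynomials. *)
Lemma span_eq0 (V : lmodType R) (g : poly2 -> V) (m : V -> R) (n : nat)
    (b : 'I_n -> V) (c : 'I_n -> R) :
  Rlinear g -> Rlinear (m \o g : poly2 -> R^o) ->
  (forall i, exists p, b i = g p) -> (forall i, m (b i) = 0) ->
  m (\sum_i c i *: b i) = 0.
Proof.
move=> gl mgl /choice[p pP] m0.
under eq_bigr do rewrite pP; rewrite -Rlinear_sum//.
rewrite -[LHS]/((m \o g : poly2 -> R^o) _) Rlinear_sum// big1// => i _.
by rewrite /= -pP m0 scaler0.
Qed.

Definition monom (e : nat * nat) : poly2 := ('X^(e.1))%:P * 'X^(e.2).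

Lemma coef_monom e a b : (monom e)`_b`_a = (e == (a, b))%:R.
Proof.
case: e => i j; rewrite /monom coefCM coefXn xpair_eqE/= [b == j]eq_sym andbC.
by case: eqP => _; rewrite ?mulr1 ?mulr0 ?coef0// coefXn [a == i]eq_sym.
Qed.

(** The common source of the bases below: [g] sends a polynomial to the function
    or field under study, and [e] lists the admissible exponents. *)
Lemma polys_in_basis (V : lmodType R) (E : nat -> nat -> bool) (T : finType)
    (e : T -> nat * nat) (g : poly2 -> V) :
  injective e -> (forall a b, E a b <-> exists t, e t = (a, b)) ->
  Rlinear g -> (forall p, polys_in E p -> g p = 0 -> p = 0) ->
  fin_basis (g @` polys_in E) (fun t => g (monom (e t))).
Proof.
move=> einj eE gl ginj.
have coefS (c : T -> R) a b : (\sum_t (c t)%:P *: monom (e t))`_b`_a =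
    \sum_t c t * (e t == (a, b))%:R.
  rewrite !coef_sum; apply: eq_bigr => t _.
  by rewrite coefZ mul_polyC coefZ coef_monom.
have coefSt c t : (\sum_t (c t)%:P *: monom (e t))`_(e t).2`_(e t).1 = c t.
  rewrite coefS (bigD1 t)//= -surjective_pairing eqxx mulr1 big1 ?addr0// => u ut.
  by rewrite (inj_eq einj) (negPf ut) mulr0.
have coefS0 c a b : ~~ E a b -> (\sum_t (c t)%:P *: monom (e t))`_b`_a = 0.
  move=> NE; rewrite coefS big1// => t _; case: eqP => [et|]; last by rewrite mulr0.
  by case/negP: NE; apply/eE; exists t.
split=> [t|c|_ [p pE <-]].
- exists (monom (e t)) => // a b; rewrite coef_monom pnatr_eq0 eqb0 negbK => /eqP ?.
  by apply/eE; exists t.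
- rewrite -Rlinear_sum// => /ginj S0 t; rewrite -(coefSt c t) S0 ?coef0//.
  by move=> a b; apply: contraR => /coefS0 ->.
- exists (fun t => p`_(e t).2`_(e t).1); rewrite -Rlinear_sum//; congr g.
  apply/polyP => b; apply/polyP => a; have [|NE] := boolP (E a b).
    move=> /eE[t et]; rewrite -[a]/(a, b).1 -[b in LHS]/(a, b).2.
    by rewrite -[b in RHS]/(a, b).2 -et coefSt.
  rewrite coefS0//; apply/eqP; apply: contraNT NE; exact: pE.
Qed.

Lemma polys_in_size m n p :
  polys_in (fun a b => (a <= m)%N && (b <= n)%N) p <->
  (size p <= n.+1)%N /\ (size (swapXY p) <= m.+1)%N.
Proof.
split=> [pE|[sp sp'] a b].
  split.
    apply/leq_sizeP => b nb; apply/polyP => a; rewrite coef0; apply/eqP.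
    by apply: contraTT nb => /pE/andP[_]; rewrite -leqNgt.
  apply/size_swapP => b; apply/leq_sizeP => a ma; apply/eqP.
  by apply: contraTT ma => /pE/andP[+ _]; rewrite -leqNgt.
apply: contraNT; rewrite negb_and -!ltnNge => /orP[ma|nb]; apply/eqP.
  rewrite nth_default// (leq_trans (size_coef_swap _ _))//.
  by rewrite (leq_trans sp').
by rewrite [p`_b]nth_default ?coef0// (leq_trans sp).
Qed.

Lemma eval2_eq0 p : eval2 p = (fun=> 0) -> p = 0.
Proof.
move=> p0; apply: (@poly_eq0_seq _ _ (fun n => (itv_pts 0 1 n : R)%:P)).
  by move=> m n /polyC_inj/itv_pts_inj; apply; rewrite ltr01.
move=> n; apply: (@poly_eq0_itv _ 0 1) => // x _.
by have := congr1 (fun f : R * R -> R => f (x, itv_pts 0 1 n)) p0.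
Qed.

Lemma Rlinear_eval2 : Rlinear (@eval2 R : poly2 -> sfield R).
Proof.
split=> [p q|c p]; apply/funext => z; rewrite /eval2.
  by rewrite !hornerD.
by rewrite -mul_polyC hornerM hornerC hornerM hornerC.
Qed.

Lemma poly_funE E : poly_fun E = (@eval2 R : poly2 -> sfield R) @` polys_in E.
Proof. by apply/seteqP; split=> f [p pE pf]; exists p. Qed.

Lemma Rlinear_radial : Rlinear (fun p => radial (eval2 p) : vfield R).
Proof.
split=> [p q|c p].
  by rewrite (proj1 Rlinear_eval2); congr pair; apply/funext => z; exact: mulrDl.
by rewrite (proj2 Rlinear_eval2); congr pair; apply/funext => z; exact/esym/mulrA.
Qed.

Lemma Rlinear_vcurl : Rlinear (fun p => vcurl (eval2 p) : vfield R).
Proof.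
split=> [p q|c p]; rewrite !vcurl_eval2.
  by rewrite derivD pderivXD opprD !(proj1 Rlinear_eval2).
rewrite derivZ (_ : - pderivX _ = c%:P *: - pderivX p) ?(proj2 Rlinear_eval2)//.
by rewrite scalerN -!mul_polyC pderivXM {1}/pderivX map_polyC/= derivC mul0r add0r.
Qed.

Definition box_expo m n (t : 'I_m * 'I_n) : nat * nat := (val t.1, val t.2).

Lemma box_expo_inj m n : injective (@box_expo m n).
Proof. by move=> [a b] [c d] [/val_inj-> /val_inj->]. Qed.

Lemma box_expoP m n a b :
  (a <= m)%N && (b <= n)%N <-> exists t : 'I_m.+1 * 'I_n.+1, box_expo t = (a, b).
Proof.
split=> [/andP[am bn]|[[i j] [<- <-]]]; last by rewrite -(ltnS i) -(ltnS j) !ltn_ord.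
by exists (Ordinal (am : (a < m.+1)%N), Ordinal (bn : (b < n.+1)%N)).
Qed.

Lemma fin_basis_polyQ m n :
  fin_basis (polyQ m n : set (sfield R))
    (fun t : 'I_m.+1 * 'I_n.+1 => eval2 (monom (box_expo t))).
Proof.
rewrite /polyQ poly_funE; apply: polys_in_basis.
- exact: box_expo_inj.
- exact: box_expoP.
- exact: Rlinear_eval2.
- by move=> p _; exact: eval2_eq0.
Qed.

Lemma polyQ_0 m n : (polyQ m n : set (sfield R)) 0.
Proof.
rewrite /polyQ poly_funE; exists 0; last exact: (Rlinear0 Rlinear_eval2).
by move=> a b; rewrite !coef0 eqxx.
Qed.

Lemma has_dim_PK k : has_dim (PK k.+1 : set (vfield R)) (k.+1 * k.+2 + k.+2 * k.+1).
Proof.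
have := fin_basis_prod (fin_basis_polyQ k k.+1) (fin_basis_polyQ k.+1 k)
  (polyQ_0 _ _) (polyQ_0 _ _).
by move/fin_basis_dim; rewrite card_sum !card_prod !card_ord.
Qed.

(** Multiplication by [y] is injective on polynomials, hence so is
    [radial]. *)
Lemma has_dim_radial n :
  has_dim [set radial q | q in (polyQ n n : set (sfield R))] (n.+1 * n.+1).
Proof.
rewrite /polyQ poly_funE image_comp.
have := @polys_in_basis _ _ _ _ _ (@box_expo_inj n.+1 n.+1) (@box_expoP n n)
  Rlinear_radial.
move=> /(_ _)/fin_basis_dim; rewrite card_prod !card_ord; apply => p _ rp.
have /eval2_eq0/eqP : eval2 (p * 'X) = fun=> 0.
  apply/funext => z; rewrite eval2M /eval2 hornerX hornerC.
  by have := congr1 (fun v : vfield R => v.2 z) rp.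
by rewrite mulf_eq0 polyX_eq0 orbF => /eqP.
Qed.

(** The kernel of the curl consists of the constants, which are excluded from
    [polyQ0]. *)
Lemma has_dim_vcurl n :
  has_dim [set vcurl phi | phi in (polyQ0 n : set (sfield R))] (n.+1 * n.+1).-1.
Proof.
rewrite /polyQ0 poly_funE image_comp.
pose T := {t : 'I_n.+1 * 'I_n.+1 | t != (ord0, ord0)}.
have -> : (n.+1 * n.+1).-1 = #|{: T}|.
  by rewrite card_sig (eq_card (B := predC1 (ord0, ord0)))// cardC1 card_prod !card_ord.
apply: (@fin_basis_dim _ T _ _ (@polys_in_basis _ _ T
   (fun t => box_expo (val t)) _ _ _ Rlinear_vcurl _)).
- by move=> s t /box_expo_inj/val_inj.
- move=> a b; split.
    move=> /and3P[an bn ab].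
    have /box_expoP[t tE] : (a <= n)%N && (b <= n)%N by rewrite an.
    have t0 : t != (ord0, ord0).
      by apply: contraTneq ab => t0; move: tE; rewrite t0 => -[<- <-].
    by exists (exist _ t t0).
  move=> [[[i j] /= ij0] [<- <-]]; rewrite -(ltnS i) -(ltnS j) !ltn_ord/=.
  by move: ij0; rewrite xpair_eqE -!val_eqE/=; case: (val i) => //; case: (val j).
- move=> p pE; rewrite vcurl_eval2 => -[/eval2_eq0 dY /eval2_eq0/eqP].
  rewrite oppr_eq0 => /eqP dX.
  have p00 : p`_0`_0 = 0.
    by apply/eqP/negPn/negP => /pE; rewrite addn0 ltnn !andbF.
  have e := deriv_eq0 (@natS_unit_poly R) dY.
  move: dX; rewrite /pderivX e map_polyC/= => /polyC_inj.
  by move=> /(deriv_eq0 (@natS_unit_field R)) ->; rewrite p00.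
Qed.

End Bases.

(** * Traces and moments on the edges *)

Section Edges.
Variable R : realType.
Local Notation poly2 := {poly {poly R}}.
Implicit Types (p q : poly2) (i : 'I_4).

(** The edge [i] is a segment of the line on which the second coordinate (for
    even [i]) or the first one (for odd [i]) equals [level i]; it is run through
    in the direction [orient i] of the other coordinate. *)
Definition level i : R := nth 0 [:: -1; 1; 1; -1] i.
Definition orient i : R := nth 0 [:: 1; 1; -1; -1] i.
Definition side_pt i (t : R) : R * R :=
  if odd i then (level i, t) else (t, level i).
Definition coord i (z : R * R) : R := if odd i then z.2 else z.1.

Lemma coord_side i t : coord i (side_pt i t) = t.
Proof. by rewrite /coord /side_pt; case: (odd i). Qed.

Lemma orientP i : orient i = 1 \/ orient i = -1.
Proof. by case: i => [[|[|[|[|//]]]] ?]; rewrite /orient/=; [left|left|right|right]. Qed.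

Lemma vertex_side i : vertex i = side_pt i (- orient i).
Proof.
by case: i => [[|[|[|[|//]]]] ?]; rewrite /vertex /side_pt /orient /level/= ?opprK.
Qed.

Lemma vertex_ordS_side i : vertex (ordS i) = side_pt i (orient i).
Proof. by case: i => [[|[|[|[|//]]]] ?]; rewrite /vertex /side_pt /orient /level. Qed.

Lemma edge_vecE i :
  edge_vec i = if odd i then (0, 2 * orient i) else (2 * orient i, 0) :> R * R.
Proof.
rewrite /edge_vec vertex_ordS_side vertex_side /side_pt.
by case: (odd i) => /=; congr pair; ring.
Qed.

Lemma edge_ptE i s : edge_pt i s = side_pt i (orient i * (2 * s - 1)).
Proof.
rewrite /edge_pt edge_vecE vertex_side /side_pt.
by case: (odd i) => /=; congr pair; ring.
Qed.

Lemma side_edge i t : -1 <= t <= 1 -> edge i (side_pt i t).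
Proof.
(* the parameter at which [edge_pt] has free coordinate [t] *)
move=> /andP[t1 t2]; exists ((orient i * t + 1) / 2).
  by rewrite /= in_itv/=; case: (orientP i) => ->; lra.
by rewrite edge_ptE; congr side_pt; case: (orientP i) => ->; field.
Qed.

Lemma edge_side i z : edge i z -> -1 <= coord i z <= 1 /\ z = side_pt i (coord i z).
Proof.
move=> [s /=]; rewrite in_itv/= => s01 <-; rewrite edge_ptE coord_side; split=> //.
by case: (orientP i) => ->; lra.
Qed.

(** The restriction to the line that contains the edge, as a polynomial in the
    free coordinate. *)
Definition trace i p : {poly R} :=
  if odd i then (swapXY p).[(level i)%:P] else p.[(level i)%:P].

Lemma eval2_side i p t : eval2 p (side_pt i t) = (trace i p).[t].
Proof. by rewrite /side_pt /trace; case: (odd i) => //; exact: eval2_swap. Qed.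

Lemma traceD i p q : trace i (p + q) = trace i p + trace i q.
Proof. by rewrite /trace; case: (odd i); rewrite ?rmorphD hornerD. Qed.

Lemma traceZ i (c : R) p : trace i (c%:P *: p) = c *: trace i p.
Proof.
rewrite /trace -mul_polyC rmorphM/= swapXY_polyC map_polyC !hornerM !hornerC.
by case: (odd i); rewrite mul_polyC.
Qed.

(** The polynomial in two variables that depends only on the free
    coordinate of the edge. *)
Definition lift_side i (h : {poly R}) : poly2 :=
  if odd i then swapXY h%:P else h%:P.

Lemma trace_lift i h : trace i (lift_side i h) = h.
Proof. by rewrite /trace /lift_side; case: (odd i); rewrite ?swapXYK hornerC. Qed.

Lemma polys_in_lift i (h : {poly R}) n : (size h <= n.+1)%N ->
  polys_in (fun a b => if odd i then (a == 0) && (b <= n) else (a <= n) && (b == 0))%N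
    (lift_side i h).
Proof.
move=> hn a b; rewrite /lift_side; case: (odd i); last first.
  rewrite coefC; case: (b =P 0%N) => _; last by rewrite coef0 eqxx.
  rewrite andbT; apply: contraNT; rewrite -ltnNge => na.
  by rewrite nth_default// (leq_trans hn).
rewrite coef_swapXY coefC; case: (a =P 0%N) => _; last by rewrite coef0 eqxx.
by apply: contraNT; rewrite -ltnNge => na; rewrite nth_default// (leq_trans hn).
Qed.

Lemma size_trace i p n : polys_in (fun a b => (a + b <= n)%N) p ->
  (size (trace i p) <= n.+1)%N.
Proof.
move=> pE; have /polys_in_size[sp sp'] :
    polys_in (fun a b => (a <= n)%N && (b <= n)%N) p.
  move=> a b /pE abn.
  by rewrite (leq_trans _ abn) ?leq_addr// (leq_trans _ abn) ?leq_addl.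
rewrite /trace; case: (odd i); rewrite (leq_trans (max_size_evalC _ _))//.
  by rewrite sizeYE swapXYK.
by rewrite sizeYE.
Qed.

Lemma patch_edge_side i (f : sfield R) t : -1 <= t <= 1 ->
  (f \_ (edge i)) (side_pt i t) = f (side_pt i t).
Proof. by move=> /(@side_edge i)/mem_set h; rewrite patchE h. Qed.

Lemma Rlinear_patch i : Rlinear (fun p => eval2 p \_ (edge i) : sfield R).
Proof.
split=> [p q|c p]; apply/funext => z; rewrite /GRing.add/GRing.scale/= !patchE;
  case: ifP => _.
- by rewrite eval2D.
- by rewrite addr0.
- by rewrite (proj2 (@Rlinear_eval2 R)).
- by rewrite scaler0.
Qed.

(** On an edge one coordinate is constant, so powers of the other one
    suffice to represent the polynomials of total degree at most [n]. *)
Lemma polyP_onE n i : polyP_on n (edge i) =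
  (fun p => eval2 p \_ (edge i) : sfield R) @` polys_in (fun a b =>
    if odd i then (a == 0) && (b <= n) else (a <= n) && (b == 0))%N.
Proof.
apply/seteqP; split=> [_ [_ [p pE ->] <-]|_ [p pE <-]].
  exists (lift_side i (trace i p)); first exact/polys_in_lift/size_trace.
  apply/funext => z; rewrite !patchE; case: ifPn => // /set_mem/edge_side[_ ->].
  by rewrite !eval2_side trace_lift.
exists (eval2 p : sfield R) => //; exists p => // a b /pE.
by case: (odd i) => /andP[]; [move=> /eqP->|move=> + /eqP->; rewrite addn0].
Qed.

Lemma has_dim_edge n i : has_dim (polyP_on n (edge i) : set (sfield R)) n.+1.
Proof.
rewrite polyP_onE -[n.+1]card_ord.
apply: (fin_basis_dim (polys_in_basis (T := 'I_n.+1)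
  (e := fun j => if odd i then (0%N, val j) else (val j, 0%N)) _ _ (Rlinear_patch i) _)).
- by move=> s t; case: (odd i) => -[] st; exact: val_inj.
- move=> a b; case: (odd i); split.
  + by move=> /andP[/eqP-> bn]; exists (Ordinal (bn : (b < n.+1)%N)).
  + by move=> [j [<- <-]]; rewrite -ltnS ltn_ord.
  + by move=> /andP[an /eqP->]; exists (Ordinal (an : (a < n.+1)%N)).
  + by move=> [j [<- <-]]; rewrite -ltnS ltn_ord.
- move=> p pE p0; have t0 : trace i p = 0.
    apply: (@poly_eq0_itv _ (-1) 1) => [|t /andP[t1 t2]]; first by lra.
    by rewrite -eval2_side -patch_edge_side ?p0// !ltW.
  have pC (q : poly2) : (forall a b, q`_b`_a != 0 -> b = 0%N) -> q = (q`_0)%:P.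
    move=> h; apply/polyP => b; rewrite coefC; case: eqP => [->//|/eqP b0].
    apply/polyP => a; rewrite coef0; apply/eqP; apply: contraNT b0 => /h ->.
    by [].
  move: t0 pE; rewrite /trace; case: (odd i) => t0 pE.
    have e : swapXY p = ((swapXY p)`_0)%:P.
      by apply: pC => a b; rewrite coef_swapXY => /pE/andP[/eqP].
    move: t0; rewrite e hornerC => e0.
    by apply/eqP; rewrite -swapXY_eq0 e e0.
  have e : p = (p`_0)%:P by apply: pC => a b /pE/andP[_ /eqP].
  by move: t0; rewrite e hornerC => ->.
Qed.

(** The free coordinate as a function of the parameter of [edge_pt]. *)
Definition edge_param i : {poly R} := (2 * orient i) *: 'X - (orient i)%:P.

Lemma horner_edge_param i s : (edge_param i).[s] = orient i * (2 * s - 1).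
Proof. by rewrite hornerD hornerN hornerZ hornerX hornerC; ring. Qed.

Definition tan_trace i p q : {poly R} := trace i (if odd i then q else p).

Lemma unit_tangentP i tau : unit_tangent i tau ->
  exists2 c : R, c != 0 & tau = if odd i then (0, c) else (c, 0).
Proof.
case: tau => a b [/=]; rewrite /dot /cross edge_vecE/=.
case: (odd i) => /= tt ct.
  have a0 : a = 0 by case: (orientP i) ct => ->; lra.
  exists b; last by rewrite a0.
  apply/eqP => b0; move: tt; rewrite a0 b0; lra.
have b0 : b = 0 by case: (orientP i) ct => ->; lra.
exists a; last by rewrite b0.
apply/eqP => a0; move: tt; rewrite b0 a0; lra.
Qed.

Lemma unit_normalP i n : unit_normal i n ->
  exists c : R, n = if odd i then (c, 0) else (0, c).
Proof.
case: n => a b [/=]; rewrite /dot edge_vecE/=.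
case: (odd i) => /= _ ct.
  by exists a; congr pair; case: (orientP i) ct => ->; lra.
by exists b; congr pair; case: (orientP i) ct => ->; lra.
Qed.

(** The constant collects the length of the edge and the sign of the
    tangent. *)
Lemma edge_moment_eval2 i tau : unit_tangent i tau -> exists2 c : R, c != 0 &
  forall p q r, edge_moment tau i (eval2 r \_ (edge i)) (eval2 p, eval2 q) =
    c * defint 0 1 ((tan_trace i p q * trace i r) \Po edge_param i).
Proof.
move=> /unit_tangentP[c c0 ->].
exists (Num.sqrt (dot (edge_vec i) (edge_vec i)) * c) => [|p q r].
  rewrite mulf_neq0// gt_eqF// sqrtr_gt0 /dot edge_vecE.
  by case: (odd i) => /=; case: (orientP i) => ->; lra.
rewrite /edge_moment /edge_integral -mulrA; congr (_ * _).
rewrite -defintZ -[RHS]/(fine (_ %:E)) -integral_horner_cc//.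
apply: eq_Rintegral => s; rewrite inE/= in_itv/= => s01.
rewrite edge_ptE patch_edge_side; last by case: (orientP i) => ->; lra.
rewrite hornerZ horner_comp horner_edge_param hornerM -!eval2_side /tan_trace.
set z := side_pt _ _; rewrite mulrA; congr (_ * _).
by rewrite /dot /at_pt/=; case: (odd i) => /=; ring.
Qed.

(** The tangential trace is itself an admissible test function. *)
Lemma tan_trace_eq0 i tau n p q : unit_tangent i tau ->
  (size (tan_trace i p q) <= n.+1)%N ->
  (forall r, polyP_on n (edge i) r -> edge_moment tau i r (eval2 p, eval2 q) = 0) ->
  tan_trace i p q = 0.
Proof.
move=> /edge_moment_eval2[c c0 mE] sT m0; set T := tan_trace i p q.
have := m0 (eval2 (lift_side i T) \_ (edge i)).
rewrite mE trace_lift -/T comp_polyM => /(_ _)/eqP.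
rewrite mulf_eq0 (negPf c0)/= => h.
have {}h : T \Po edge_param i = 0.
  apply: (@defint_sqr_eq0 _ 0 1); first by lra.
  apply/eqP/h; rewrite polyP_onE; exists (lift_side i T) => //.
  exact: polys_in_lift.
apply: (@poly_eq0_itv _ (-1) 1) => [|t _]; first by lra.
(* this parameter is sent to [t] by [edge_param i] *)
have := congr1 (fun r : {poly R} => r.[(orient i * t + 1) / 2]) h.
rewrite horner_comp horner_edge_param horner0 => <-; congr horner.
by case: (orientP i) => ->; field.
Qed.

(** The nodes of an edge, end points included, are [k] distinct roots of a
    polynomial of size at most [k]. *)
Lemma trace_eq0_nodes i k (pint : 'I_4 -> 'I_(k - 2) -> R * R) p :
  (2 <= k)%N ->
  (forall i j, edge_interior i (pint i j)) -> (forall i, injective (pint i)) ->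
  (size (trace i p) <= k)%N ->
  (forall j : nodes_index k, edge i (node pint j) -> eval2 p (node pint j) = 0) ->
  trace i p = 0.
Proof.
move=> k2 pE pinj sp p0.
have int_coord j : -1 < coord i (pint i j) < 1 /\
    pint i j = side_pt i (coord i (pint i j)).
  have [s /=] := pE i j; rewrite in_itv/= => s01 <-.
  rewrite edge_ptE coord_side; split => //.
  by case: (orientP i) => ->; lra.
have edge_or : edge i (side_pt i (orient i)).
  by apply: side_edge; case: (orientP i) => ->; lra.
have edge_Nor : edge i (side_pt i (- orient i)).
  by apply: side_edge; case: (orientP i) => ->; lra.
apply: (@roots_geq_poly_eq0 _ _ [:: - orient i, orient i &
  [seq coord i (pint i j) | j <- enum 'I_(k - 2)]]).
- rewrite /= !rootE -!eval2_side; apply/and3P; split.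
  + by have := p0 (inl i); rewrite /= vertex_side => ->.
  + by have := p0 (inl (ordS i)); rewrite /= vertex_ordS_side => ->.
  + apply/allP => _ /mapP[j _ ->]; rewrite rootE -eval2_side.
    have [c1 c2] := int_coord j; rewrite -c2.
    apply/eqP; apply: (p0 (inr (i, j))); rewrite /= c2.
    by apply: side_edge; rewrite !ltW//; case/andP: c1.
- rewrite /= inE negb_or -!andbA; apply/and4P; split.
  + by case: (orientP i) => ->; apply/eqP; lra.
  + apply/mapP => -[j _ e]; have [+ _] := int_coord j; rewrite -e.
    by case: (orientP i) => ->; lra.
  + apply/mapP => -[j _ e]; have [+ _] := int_coord j; rewrite -e.
    by case: (orientP i) => ->; lra.
  + rewrite map_inj_uniq ?enum_uniq// => j j' e; apply: (pinj i).
    by have [_ ->] := int_coord j; have [_ ->] := int_coord j'; rewrite e.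
- by rewrite /= size_map -cardE card_ord -addn2 subnK.
Qed.

End Edges.

(** * The element *)

(** The degree is [k = n + 3], which makes the truncated subtractions [k - 1],
    [k - 2] and [k - 3] disappear. *)
Section Element.
Variables (R : realType) (n : nat).
Local Notation k := n.+3.
Local Notation poly2 := {poly {poly R}}.

Lemma PK_eval2 (u : vfield R) : PK k u -> exists U1 U2 : poly2,
  [/\ u = (eval2 U1, eval2 U2),
      (size U1 <= n.+4)%N /\ (size (swapXY U1) <= n.+3)%N
    & (size U2 <= n.+3)%N /\ (size (swapXY U2) <= n.+4)%N].
Proof.
case: u => u1 u2 [/= [U1 /polys_in_size s1 ->] [U2 /polys_in_size s2 ->]].
by exists U1, U2.
Qed.

Section Field.
Variables U1 U2 : poly2.
Hypothesis s1 : (size U1 <= n.+4)%N /\ (size (swapXY U1) <= n.+3)%N.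
Hypothesis s2 : (size U2 <= n.+3)%N /\ (size (swapXY U2) <= n.+4)%N.

Lemma size_tan_trace i : (size (tan_trace i U1 U2) <= n.+3)%N.
Proof.
rewrite /tan_trace /trace; case: (odd i);
  rewrite (leq_trans (max_size_evalC _ _))// sizeYE ?swapXYK.
  by case: s2.
by case: s1.
Qed.

Local Notation curl_poly := (pderivX U2 - U1^`()).

Lemma size_curl : (size curl_poly <= n.+3)%N /\
  (size (swapXY curl_poly) <= n.+3)%N.
Proof.
have lt_deriv (A : nzRingType) (p : {poly A}) m :
    (size p <= m.+1)%N -> (size p^`() <= m)%N.
  by move=> pm; rewrite (leq_trans (size_poly _ _))//; case: (size p) pm.
case: s1 s2 => [a b] [c d]; split.
  rewrite (leq_trans (size_polyD _ _))// size_polyN geq_max.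
  by rewrite (leq_trans (size_pderivX _))//= lt_deriv.
rewrite rmorphB/= swapXY_pderivX.
rewrite (leq_trans (size_polyD _ _))// size_polyN geq_max.
by rewrite (leq_trans (size_swap_deriv _)) ?andbT// lt_deriv.
Qed.

Lemma size_trace_curl i : (size (trace i curl_poly) <= n.+3)%N.
Proof.
rewrite /trace; case: (odd i); rewrite (leq_trans (max_size_evalC _ _))// sizeYE.
  by rewrite swapXYK; case: size_curl.
by case: size_curl.
Qed.

End Field.

Lemma element_conforming (pint : 'I_4 -> 'I_(k - 2) -> R * R) (tau : 'I_4 -> R * R) :
  (forall i j, edge_interior i (pint i j)) -> (forall i, injective (pint i)) ->
  (forall i, unit_tangent i (tau i)) -> conforming pint tau.
Proof.
move=> pE pinj tauP i m u /unit_normalP[c ->] /PK_eval2[U1 [U2 [-> s1 s2]]].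
rewrite curl_eval2 => C0 m0 z /edge_side[zi ->].
have T0 := tan_trace_eq0 (tauP i) (size_tan_trace s1 s2 i) m0.
have C0' := trace_eq0_nodes (isT : (1 < k)%N) pE pinj (size_trace_curl s1 s2 i) C0.
rewrite eval2_side C0' horner0; split => //.
move: T0; rewrite /tan_trace /cross /at_pt/= !eval2_side.
by case: (odd i) => ->; rewrite horner0 /=; ring.
Qed.

(** The identity
    [4 (k - 1) + 4 k + (k - 1)^2 + (k - 2)^2 - 1 = 2 k (k + 1)]. *)
Lemma card_dof (ne : 'I_4 -> nat) m1 m2 : (forall i, ne i = k) ->
  m1 = (n.+2 * n.+2)%N -> m2 = (n.+1 * n.+1).-1 ->
  #|dof_index k ne m1 m2| = (k * k.+1 + k.+1 * k)%N.
Proof.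
move=> nek -> ->; rewrite !card_sum !card_prod !card_ord card_tagged.
rewrite sumnE big_map big_enum/=.
under eq_bigr do rewrite card_ord nek.
rewrite sum_nat_const card_ord; lia.
Qed.

Lemma square_moment_radial (U1 U2 q : poly2) :
  square_moment (radial (eval2 q)) (eval2 U1, eval2 U2) =
  defint2 (U1 * (q * 'X%:P) + U2 * (q * 'X)).
Proof.
rewrite -square_integral_eval2 /square_moment; congr square_integral.
apply/funext => z; rewrite eval2D !eval2M /dot /at_pt/=.
by rewrite /eval2 !hornerX !hornerC hornerX.
Qed.

Lemma square_moment_vcurl (U1 U2 phi : poly2) :
  square_moment (vcurl (eval2 phi)) (eval2 U1, eval2 U2) =
  defint2 (U1 * phi^`() - U2 * pderivX phi).
Proof.
rewrite -square_integral_eval2 /square_moment vcurl_eval2 -mulrN.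
by congr square_integral; apply/funext => z; rewrite eval2D !eval2M.
Qed.

Lemma element_unisolvent
  (pint : 'I_4 -> 'I_(k - 2) -> R * R)
  (pint_edge : forall i j, edge_interior i (pint i j))
  (pint_inj : forall i, injective (pint i))
  (tau : 'I_4 -> R * R) (tauP : forall i, unit_tangent i (tau i))
  (ne : 'I_4 -> nat) (qe : forall i, 'I_(ne i) -> sfield R)
  (qeP : forall i, is_basis (polyP_on k.-1 (edge i)) (qe i))
  (m1 : nat) (q1 : 'I_m1 -> vfield R)
  (q1P : is_basis [set radial q | q in polyQ n.+1 n.+1] q1)
  (m2 : nat) (q2 : 'I_m2 -> vfield R)
  (q2P : is_basis [set vcurl phi | phi in polyQ0 n] q2) :
  unisolvent (PK k) (dof pint tau qe q1 q2).
Proof.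
split.
  rewrite card_dof; first exact: has_dim_PK.
  - move=> i; exact: (dim_unique (qeP i) (has_dim_edge _ n.+2 i)).
  - exact: (dim_unique q1P (has_dim_radial _ _)).
  - exact: (dim_unique q2P (has_dim_vcurl _ _)).
move=> _ /PK_eval2[U1 [U2 [-> s1 s2]]] dof0.
have T0 i : tan_trace i U1 U2 = 0.
  apply: (tan_trace_eq0 (tauP i) (size_tan_trace s1 s2 i)) => q.
  have [Sq _ spanq] := qeP i => /spanq[c ->].
  apply: (span_eq0 (g := fun p => eval2 p \_ (edge i) : sfield R)
    (m := fun q => edge_moment (tau i) i q (eval2 U1, eval2 U2))).
  - exact: Rlinear_patch.
  - have [d _ mE] := edge_moment_eval2 (tauP i); split=> [p r|a p] /=; rewrite !mE.
      by rewrite traceD (mulrDr (tan_trace _ _ _)) comp_polyD raddfD (mulrDr d).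
    by rewrite traceZ -scalerAr comp_polyZ defintZ mulrCA.
  - by move=> j; have := Sq j; rewrite polyP_onE => -[p _ <-]; exists p.
  - by move=> j; exact: (dof0 (inl (inl (inr (existT _ i j))))).
have C0 i : trace i (pderivX U2 - U1^`()) = 0.
  apply: (trace_eq0_nodes (isT : (1 < k)%N) pint_edge pint_inj
    (size_trace_curl s1 s2 i)) => j _.
  by rewrite -curl_eval2; exact: (dof0 (inl (inl (inl j)))).
have phi0 (phi : poly2) : polys_in (fun a b => [&& a <= n, b <= n & 0 < a + b]%N) phi ->
    defint2 (U1 * phi^`() - U2 * pderivX phi) = 0.
  move=> phiE; rewrite -square_moment_vcurl.
  have [Sq _ spanq] := q2P.
  have /spanq[c ->] : [set vcurl phi | phi in polyQ0 n] (vcurl (eval2 phi)).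
    by exists (eval2 phi : sfield R) => //; exists phi.
  apply: (span_eq0 (g := fun p => vcurl (eval2 p) : vfield R)
    (m := fun q => square_moment q (eval2 U1, eval2 U2))).
  - exact: Rlinear_vcurl.
  - split=> [p r|a p] /=; rewrite !square_moment_vcurl.
      by rewrite -raddfD derivD pderivXD; congr defint2; ring.
    rewrite -[RHS]defint2Z derivZ scalerBr scalerAr; congr (defint2 (_ - _)).
    by rewrite -!mul_polyC pderivXM {1}/pderivX map_polyC/= derivC mul0r add0r; ring.
  - by move=> j; have [_ [p _ ->] <-] := Sq j; exists p.
  - by move=> j; exact: (dof0 (inr j)).
have q0 (q : poly2) : polys_in (fun a b => (a <= n.+1) && (b <= n.+1))%N q ->
    defint2 (U1 * (q * 'X%:P) + U2 * (q * 'X)) = 0.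
  move=> qE; rewrite -square_moment_radial.
  have [Sq _ spanq] := q1P.
  have /spanq[c ->] : [set radial q | q in polyQ n.+1 n.+1] (radial (eval2 q)).
    by exists (eval2 q : sfield R) => //; exists q.
  apply: (span_eq0 (g := fun p => radial (eval2 p) : vfield R)
    (m := fun q => square_moment q (eval2 U1, eval2 U2))).
  - exact: Rlinear_radial.
  - split=> [p r|a p] /=; rewrite !square_moment_radial.
      by rewrite -raddfD; congr defint2; ring.
    by rewrite -[RHS]defint2Z -!mul_polyC; congr defint2; ring.
  - by move=> j; have [_ [p _ ->] <-] := Sq j; exists p.
  - by move=> j; exact: (dof0 (inl (inr j))).
have [[sU1 sU1'] [sU2 sU2']] := (s1, s2).
(* the edges 0, 1, 2 and 3 are the bottom, right, top and left sides *)
have T i := T0 (inord i); have C i := C0 (inord i).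
have := (T 0%N, T 1%N, T 2%N, T 3%N); have := (C 0%N, C 1%N, C 2%N, C 3%N).
rewrite /tan_trace /trace /level !inordK//= => -[[[Cb Cr] Ct] Cl] [[[Tb Tr] Tt] Tl].
have cf : pderivX U2 = U1^`().
  apply: (curl_free sU1 sU1' sU2 sU2' Tt Tb Tr Tl) => [|phi sp sp' p0]; first by split.
  apply: phi0 => a b pab; move: (pab).
  have /[apply] := (polys_in_size n n phi).2 (conj sp sp') a b.
  move=> /andP[-> ->]/=; rewrite lt0n addn_eq0; apply/negP => /andP[/eqP a0 /eqP b0].
  by move: pab; rewrite a0 b0 p0 eqxx.
have [|-> ->] := field_eq0 sU2 sU2' Tt Tb Tr Tl cf.
  by move=> q sq sq'; apply: q0; apply/polys_in_size.
by rewrite (Rlinear0 (@Rlinear_eval2 R)).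
Qed.

End Element.

Theorem theorem3p2 (R : realType) (k : nat) (hk : (3 <= k)%N)
  (pint : 'I_4 -> 'I_(k - 2) -> R * R)
  (pint_edge : forall i j, edge_interior i (pint i j))
  (pint_inj : forall i, injective (pint i))
  (tau : 'I_4 -> R * R) (tauP : forall i, unit_tangent i (tau i))
  (ne : 'I_4 -> nat) (qe : forall i, 'I_(ne i) -> sfield R)
  (qeP : forall i, is_basis (polyP_on k.-1 (edge i)) (qe i))
  (m1 : nat) (q1 : 'I_m1 -> vfield R)
  (q1P : is_basis [set radial q | q in polyQ (k - 2) (k - 2)] q1)
  (m2 : nat) (q2 : 'I_m2 -> vfield R)
  (q2P : is_basis [set vcurl phi | phi in polyQ0 (k - 3)] q2) :
  unisolvent (PK k) (dof pint tau qe q1 q2) /\ conforming pint tau.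
Proof.
have [n kE] : exists n, k = n.+3 by exists (k - 3)%N; rewrite -addn3 subnK.
subst k; rewrite !subSS subn0 in q2P.
split; last exact: element_conforming.
exact: element_unisolvent.
Qed.
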